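(* Let $$G=-\int_{1/2}^{1}\frac{\ln x}{\ln\left(\frac{10}{9}\right)(x+1)(x+2)}\,dx .$$ Then for almost all $x\in[\frac12,1]$ with respect to Lebesgue measure $\lambda$, $$\lim_{n\to\infty}\sqrt[n]{\lambda(\Delta_n(x))}=e^{-2G},$$ where $\Delta_n(x)$ is the $n$-th level cylinder of the $A_2$-representation determined by the first $n$ digits of $x$.
   Context: For a sequence $(a_n)$ of positive reals, $[a_1;a_2;\dots;a_k]$ denotes the finite continued fraction $\cfrac{1}{a_1+\cfrac{1}{a_2+\dots+\cfrac{1}{a_k}}}$, and $[a_1;a_2;\dots;a_k;\dots]=\lim_{k\to\infty}[a_1;\dots;a_k]$ (the limit exists whenever $\sum a_n$ diverges, in particular when all $a_n\in\{\frac12,1\}$). Every $t\in[\frac12,1]$ can be written as $t=[b_1;b_2;\dots;b_n;\dots]$ with digits $b_n\in\{\frac12,1\}$ for all $n$; this is called an $A_2$-representation of $t$. The representation is unique except for a countable set of numbers, called $A_2$-binary, which have exactly two representations, of the form $[b_1;\dots;b_n;\frac12;(\frac12;1)]=[b_1;\dots;b_n;1;(1;\frac12)]$ with $n\ge0$, where parentheses denote the period. Convention: for $A_2$-binary numbers the representation $[b_1;\dots;b_n;\frac12;(\frac12;1)]$ with period $(\frac12;1)$ is not used (the other one is used). For $\gamma_1,\dots,\gamma_n\in\{\frac12,1\}$ the $n$-th level cylinder is the closed interval $\Delta_n(\gamma_1;\dots;\gamma_n)=\{[\gamma_1;\dots;\gamma_n;\sigma_1;\sigma_2;\dots;\sigma_k;\dots]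 : \sigma_k\in\{\frac12,1\}\ \forall k\in\mathbb{N}\}$. For $x=[a_1;a_2;\dots]\in[\frac12,1]$ (chosen $A_2$-representation), $\Delta_n(x)=\Delta_n(a_1;\dots;a_n)$. *)

(* Defs.v *)
From HB Require Import structures.
From mathcomp Require Import all_boot all_order all_algebra.
From mathcomp Require Import all_classical all_reals all_analysis.
Import Order.TTheory GRing.Theory Num.Theory.
Import numFieldNormedType.Exports.

Set Implicit Arguments.
Unset Strict Implicit.
Unset Printing Implicit Defensive.

Local Open Scope classical_set_scope.
Local Open Scope ring_scope.

(* Digit sequences are indexed from 0, so [a 0] is the digit written a_1, and
   [mkseq a n] lists the first n digits. *)

(* contfrac [:: a_1; ...; a_k] = 1 / (a_1 + 1 / (a_2 + ... + 1 / a_k)) *)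
Fixpoint contfrac (R : realType) (s : seq R) : R :=
  if s is a :: s' then (a + contfrac s')^-1 else 0.

Definition A2_digits (R : realType) (a : nat -> R) : Prop :=
  forall n, a n = 2^-1 \/ a n = 1.

Definition A2_representation (R : realType) (a : nat -> R) (x : R) : Prop :=
  A2_digits a /\ contfrac (mkseq a k) @[k --> \oo] --> x.

(* a = [b_1; ...; b_n; 1/2; (1/2; 1)] for some n >= 0: the representation of
   an A2-binary number that is not used. *)
Definition A2_unused (R : realType) (a : nat -> R) : Prop :=
  exists n, a n = 2^-1 /\
    forall k, a (n + 1 + 2 * k)%N = 2^-1 /\ a (n + 2 + 2 * k)%N = 1.

(* The chosen representation of x. Every x in [1/2, 1] has exactly one that is
   not A2_unused, so the default value given to xget only matters for x outside
   of [1/2, 1]. *)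
Definition A2_rep (R : realType) (x : R) : nat -> R :=
  xget (fun=> 1) [set a | A2_representation a x /\ ~ A2_unused a].

(* The cylinder with base g_1, ..., g_n, where g = [:: g_1; ...; g_n]. *)
Definition A2_cylinder (R : realType) (g : seq R) : set R :=
  [set x | exists2 s : nat -> R, A2_digits s &
    contfrac (g ++ mkseq s k) @[k --> \oo] --> x].

Definition A2_cylinder_at (R : realType) (n : nat) (x : R) : set R :=
  A2_cylinder (mkseq (A2_rep x) n).

Definition A2_G (R : realType) : R :=
  - \int[@lebesgue_measure R]_(x in `[2^-1, 1])
      (ln x / (ln (10 / 9) * (x + 1) * (x + 2))).

(* Main.v *)
(** The Gauss-type map of the expansion has two full branches [x -> 1/x - a],
    and [1 / ((x + 1) (x + 2))] is, up to a factor, its invariant density. The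
    cylinder of a word [w] has length [1/2 / (den w 1 * den w (1/2))], where
    [ln (den w y)] is minus the sum of [ln] along the tails of [w] and
    [den w (1/2) <= den w 1 <= 2 den w (1/2)], so the claim is the ergodic
    theorem for [ln].  That special case needs no general ergodic theorem: read
    from its last digit to its first, a word is a trajectory of a Markov chain
    whose operator [transfer] contracts Lipschitz constants on [[1/2, 1]] by
    13/16, so its iterates on [ln] tend uniformly to the mean of [ln].  Their
    partial sums then solve the Poisson equation up to an arbitrarily small
    error, which turns the Birkhoff sum of [ln] into a martingale with bounded
    increments; an exponential moment bound and the Borel-Cantelli lemma
    conclude. *)
Require Import Defs.
From HB Require Import structures.
From mathcomp Require Import all_boot all_order all_algebra.
From mathcomp Require Import all_classical all_reals all_analysis.
From mathcomp Require Import ring lra.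
Import Order.TTheory GRing.Theory Num.Theory.
Import numFieldNormedType.Exports.

Local Open Scope classical_set_scope.
Local Open Scope ring_scope.

Set Implicit Arguments.
Unset Strict Implicit.

(** * Inverse branches as Möbius maps and their denominators *)

Section Branches.
Context {R : realType}.
Implicit Types (a x y u v : R) (w : seq R).

Definition digit a := (a == 2^-1) || (a == 1).

(* [psi w] is the inverse branch coded by [w]; up to sign, its derivative at [y]
   is [den w y ^- 2]. *)
Definition psi w y := foldr (fun a z => (a + z)^-1) y w.

Fixpoint den w y := if w is a :: w' then (a + psi w' y) * den w' y else 1.

Lemma digitP a : digit a -> a = 2^-1 \/ a = 1.
Proof. by case/orP => /eqP ->; [left|right]. Qed.

Lemma digit_bounds a : digit a -> 2^-1 <= a <= 1.
Proof. by case/digitP=> ->; lra. Qed.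

Lemma contfracE w : contfrac w = psi w 0.
Proof. by elim: w => //= a w ->. Qed.

Lemma psi_ge0 w y : all digit w -> 0 <= y -> 0 <= psi w y.
Proof.
move=> + y0; elim: w => //= a w IH /andP[/digit_bounds aP /IH pw].
by rewrite invr_ge0; lra.
Qed.

Lemma psi_le2 w y : all digit w -> 0 <= y <= 2 -> 0 <= psi w y <= 2.
Proof.
move=> + y2; elim: w => //= a w IH /andP[/digit_bounds aP /IH pw].
apply/andP; split; first by rewrite invr_ge0; lra.
by rewrite -[leRHS]invrK lef_pV2 ?posrE; lra.
Qed.

Lemma psi_itv w y : all digit w -> 2^-1 <= y <= 1 -> 2^-1 <= psi w y <= 1.
Proof.
move=> + y0; elim: w => //= a w IH /andP[/digit_bounds aP /IH pw].
by apply/andP; split; [rewrite lef_pV2 ?posrE|rewrite invf_le1]; lra.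
Qed.

Lemma den_gt0 w y : all digit w -> 0 <= y -> 0 < den w y.
Proof.
move=> + y0; elim: w => //= a w IH /andP[/digit_bounds aP dw].
by have := psi_ge0 dw y0; have := IH dw => *; apply: mulr_gt0 => //; lra.
Qed.

(** As functions of [y], [den w y] and the numerator [psi w y * den w y] are affine with nonnegative
    coefficients, and such functions at most double from 1/2 to 1. Prepending [a] turns the pair
    (numerator, denominator) into (den, a den + num), so both are carried through the induction. *)
Lemma den_half w : all digit w -> den w 2^-1 <= den w 1 <= 2 * den w 2^-1.
Proof.
move=> dw; suff : den w 2^-1 <= den w 1 <= 2 * den w 2^-1 /\
  psi w 2^-1 * den w 2^-1 <= psi w 1 * den w 1
    <= 2 * (psi w 2^-1 * den w 2^-1) by case.
elim: w dw => /= [_|a w IH /andP[/digit_bounds aP dw]]; first by split; lra.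
have [D N] := IH dw.
have p0 : 0 <= psi w 2^-1 by apply: psi_ge0 => //; lra.
have p1 : 0 <= psi w 1 by apply: psi_ge0 => //; lra.
have -> : (a + psi w 2^-1)^-1 * ((a + psi w 2^-1) * den w 2^-1) = den w 2^-1.
  by rewrite mulrA mulVf ?mul1r//; lra.
have -> : (a + psi w 1)^-1 * ((a + psi w 1) * den w 1) = den w 1.
  by rewrite mulrA mulVf ?mul1r//; lra.
by split=> //; nra.
Qed.

(** A Möbius map of determinant 1 or -1 satisfies this distance formula exactly. *)
Lemma psi_dist w u v : all digit w -> 0 <= u -> 0 <= v ->
  `|psi w u - psi w v| = `|u - v| / (den w u * den w v).
Proof.
move=> + u0 v0; elim: w => /= [_|a w IH /andP[/digit_bounds aP dw]].
  by rewrite mulr1 divr1.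
have pu : 0 <= psi w u by apply: psi_ge0.
have pv : 0 <= psi w v by apply: psi_ge0.
have Du := den_gt0 dw u0; have Dv := den_gt0 dw v0.
have -> : (a + psi w u)^-1 - (a + psi w v)^-1 =
    (psi w v - psi w u) / ((a + psi w u) * (a + psi w v)).
  by field; apply/andP; split; lra.
rewrite normrM distrC IH// normfV (ger0_norm (x := _ * _)); last by nra.
by field; rewrite !gt_eqF//; lra.
Qed.

(** The slowest growth comes from digits 1/2. The rate r = 5/4 satisfies r^2 <= r/2 + 1, and 2/5
    makes the second bound an equality for the empty word at [y = 0]. That second bound is the one
    for the next denominator with digit 1/2. *)
Lemma den_ge w y : all digit w -> 0 <= y ->
  2 / 5 * (5 / 4) ^+ size w <= den w y.
Proof.
move=> + y0 => dw; suff : 2 / 5 * (5 / 4) ^+ size w <= den w y /\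
    2 / 5 * (5 / 4) ^+ (size w).+1 <= 2^-1 * den w y + psi w y * den w y.
  by case.
elim: w dw => /= [_|a w IH /andP[/digit_bounds aP dw]].
  by split; rewrite ?expr0 ?expr1; lra.
have [] := IH dw; rewrite !exprS; set r := (5 / 4) ^+ size w => D N.
have p0 : 0 <= psi w y by apply: psi_ge0.
have -> : (a + psi w y)^-1 * ((a + psi w y) * den w y) = den w y.
  by rewrite mulrA mulVf ?mul1r//; lra.
have r0 : 0 < r by rewrite exprn_gt0//; lra.
by split; nra.
Qed.

Lemma psi_dist0 w y : all digit w -> 0 <= y <= 1 ->
  `|psi w y - psi w 0| <= 25 / 4 * (4 / 5) ^+ size w.
Proof.
move=> dw /andP[y0 y1]; rewrite psi_dist// subr0 ger0_norm//.
have D0 := den_ge dw (lexx 0); have Dy := den_ge dw y0.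
have -> : 4 / 5 = (5 / 4)^-1 :> R by rewrite invf_div.
rewrite exprVn; move: D0 Dy; set r := (5 / 4) ^+ size w => D0 Dy.
have r1 : 1 <= r by rewrite exprn_ege1//; lra.
rewrite ler_pdivrMr; last by nra.
apply: (le_trans y1); rewrite mulrAC ler_pdivlMr ?mul1r; last by lra.
suff : 2 / 5 * r * (2 / 5) <= den w y * den w 0 by lra.
by apply: ler_pM; nra.
Qed.

Lemma psi_cat w1 w2 y : psi (w1 ++ w2) y = psi w1 (psi w2 y).
Proof. exact: foldr_cat. Qed.

End Branches.

(** * Existence of the chosen representation *)

Section Representation.
Context {R : realType}.
Implicit Types (x y : R) (a s : nat -> R) (w : seq R).

Lemma digits_mkseq s n : A2_digits s -> all digit (mkseq s n).
Proof.
move=> ds; apply/allP => x /mapP[k _ ->].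
by case: (ds k) => ->; rewrite /digit eqxx ?orbT.
Qed.

(** Truncation puts 0 in place of the tail; this allows any tails in [0, 1] instead without changing
    the limit. *)
Lemma psi_contfrac_cvg0 s (y : nat -> R) : A2_digits s ->
  (forall k, 0 <= y k <= 1) ->
  psi (mkseq s k) (y k) - contfrac (mkseq s k) @[k --> \oo] --> 0.
Proof.
move=> ds y01; have G : geometric (25 / 4) (4 / 5 : R) @ \oo --> 0.
  by apply: cvg_geometric; rewrite ger0_norm; lra.
have G' : - geometric (25 / 4) (4 / 5 : R) @ \oo --> 0.
  by rewrite -[0]oppr0; exact: cvgN.
apply: (squeeze_cvgr _ G' G); near=> k; rewrite -ler_norml contfracE /geometric /=.
by have := psi_dist0 (digits_mkseq k ds) (y01 k); rewrite size_mkseq.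
Unshelve. all: by end_near. Qed.

Lemma contfrac_lim_itv s x : A2_digits s ->
  contfrac (mkseq s k) @[k --> \oo] --> x -> 2^-1 <= x <= 1.
Proof.
move=> ds cx.
have o1 (k : nat) : 0 <= (fun=> 1 : R) k <= 1 by rewrite ler01 lexx.
have := cvgD (psi_contfrac_cvg0 ds o1) cx; rewrite add0r => P.
have {}P : psi (mkseq s k) 1 @[k --> \oo] --> x.
  by under eq_fun => k do rewrite -[psi _ _](subrK (contfrac (mkseq s k))); exact: P.
have I k : 2^-1 <= psi (mkseq s k) 1 <= 1.
  by apply: psi_itv; [exact: digits_mkseq|clear; lra].
have cl : closed [set` `[2^-1 : R, 1]] by exact: itv_closed.
have /= := @closed_cvg _ _ _ _ _ _ cl _ x P.
by rewrite in_itv; apply; near=> k; rewrite /= in_itv; exact: I.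
Unshelve. all: by end_near. Qed.

(** The branch images [1/2, 2/3] and [2/3, 1] share the point 2/3. It gets the digit 1, in
    accordance with the convention for A_2-binary numbers. *)
Definition gdigit x : R := if x <= 2 / 3 then 1 else 2^-1.

Definition gmap x : R := x^-1 - gdigit x.

Definition grep x n : R := gdigit (iter n gmap x).

Lemma gmap_itv x : 2^-1 <= x <= 1 -> 2^-1 <= gmap x <= 1.
Proof.
rewrite /gmap /gdigit => /andP[x0 x1]; have xx : x * x^-1 = 1 by field; lra.
by case: (leP x (2 / 3)) => *; apply/andP; split; nra.
Qed.

Lemma iter_gmap_itv n x : 2^-1 <= x <= 1 -> 2^-1 <= iter n gmap x <= 1.
Proof. by move=> xI; elim: n => //= n; apply: gmap_itv. Qed.

Lemma grep_digits x : A2_digits (grep x).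
Proof. by move=> n; rewrite /grep /gdigit; case: ifP; [right|left]. Qed.

Lemma psi_grep x n : 2^-1 <= x <= 1 -> psi (mkseq (grep x) n) (iter n gmap x) = x.
Proof.
move=> xI; elim: n => // n IH; rewrite mkseqS -cats1 psi_cat -[RHS]IH /=.
by rewrite {1}/gmap /grep addrC subrK invrK.
Qed.

Lemma grep_cvg x : 2^-1 <= x <= 1 ->
  contfrac (mkseq (grep x) k) @[k --> \oo] --> x.
Proof.
move=> xI.
have I k : 0 <= (fun k => iter k gmap x) k <= 1.
  by have /andP[? ?] := iter_gmap_itv k xI; apply/andP; split; lra.
have := cvgB (cvg_cst x) (psi_contfrac_cvg0 (@grep_digits x) I).
rewrite subr0 => P; have E k : contfrac (mkseq (grep x) k) =
    x - (psi (mkseq (grep x) k) (iter k gmap x) - contfrac (mkseq (grep x) k)).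
  by rewrite psi_grep// subKr.
by under eq_fun => k do rewrite E; exact: P.
Qed.

(* The unused tail [(1/2; 1)] represents 1, a repelling fixed point of the
   square of [gmap] along the digits 1/2, 1. *)
Lemma grep_used x : 2^-1 <= x <= 1 -> ~ A2_unused (grep x).
Proof.
move=> xI [n [an tl]].
have gh z : gdigit z = 2^-1 -> 2 / 3 < z.
  by rewrite /gdigit; case: ltP => // _ ?; lra.
pose z k := iter (n + 1 + 2 * k)%N gmap x.
have zI k : 2^-1 <= z k <= 1 by exact: iter_gmap_itv.
(* The digit 1/2 at index [n] forces the orbit point there strictly above 2/3, hence its image
   strictly below 1. From then on each period at least doubles the distance to 1, which the interval
   forbids. *)
have z0 : z 0%N < 1.
  rewrite /z muln0 addn0 addn1 /= /gmap.
  have := an; rewrite /grep => g2; rewrite g2; have := gh _ g2.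
  have /andP[y0 y1] := iter_gmap_itv n xI.
  set y := iter n gmap x in y0 y1 *; move=> y2.
  have yy : y * y^-1 = 1 by field; lra.
  by nra.
have zS k : 2 * (1 - z k) <= 1 - z k.+1.
  have [g1 g2] := tl k.
  have e2 : (n + 2 + 2 * k = (n + 1 + 2 * k).+1)%N by rewrite addn2 addn1.
  have e3 : (n + 1 + 2 * k.+1 = (n + 1 + 2 * k).+2)%N by rewrite mulnS addnCA.
  have -> : z k.+1 = ((z k)^-1 - 2^-1)^-1 - 1.
    rewrite /z e3 /= {1}/gmap; move: g2; rewrite /grep e2 /= => ->.
    by rewrite {1}/gmap; move: g1; rewrite /grep => ->.
  have zg : 2 / 3 < z k by apply: gh.
  have /andP[_ y1] := zI k; set y := z k in y1 zg *.
  have -> : (y^-1 - 2^-1)^-1 = 2 * y / (2 - y) by field; lra.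
  have : 2 * y / (2 - y) * (2 - y) = 2 * y by field; lra.
  by set q := _ / _; nra.
have P k : 2 ^+ k * (1 - z 0%N) <= 1 - z k.
  elim: k => [|k IH]; first by rewrite expr0 mul1r.
  by apply: le_trans (zS k); rewrite exprS -mulrA ler_pM2l.
have d0 : 0 < 1 - z 0%N by lra.
have := archi_boundP (ltW (eqbRL (invr_gt0 _) d0)).
set k := Num.Def.archi_bound _ => kd.
have : 1 < 2 ^+ k * (1 - z 0%N).
  rewrite -ltr_pdivrMr// mul1r (lt_le_trans kd)// -natrX ler_nat ltnW//.
  exact: ltn_expl.
by have := P k; have /andP[] := zI k; lra.
Qed.

Lemma A2_repP x : 2^-1 <= x <= 1 -> A2_representation (A2_rep x) x.
Proof.
move=> xI; suff [] : [set a | A2_representation a x /\ ~ A2_unused a] (A2_rep x).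
  by [].
apply: (@xgetPex _ _ [set a | A2_representation a x /\ ~ A2_unused a]).
exists (grep x); split; last exact: grep_used.
by split; [exact: grep_digits|exact: grep_cvg].
Qed.

End Representation.

(** * Cylinders as intervals and their lengths *)

Section Cylinder.
Context {R : realType}.
Implicit Types (x y a : R) (w : seq R).

Lemma A2_cylinder_nil : A2_cylinder [::] = `[2^-1 : R, 1]%classic.
Proof.
apply/seteqP; split=> x /=; rewrite in_itv /=.
  by case=> s; exact: contfrac_lim_itv.
by move=> xI; exists (grep x); [exact: grep_digits|exact: grep_cvg].
Qed.

Lemma A2_cylinder_cons a w : digit a -> all digit w ->
  A2_cylinder (a :: w) = (fun y => (a + y)^-1) @` A2_cylinder w.
Proof.
move=> /digit_bounds aP dw.
(* Truncated fractions may leave [1/2, 1], but [0, 2] is enough to keep the limit [x] at least 1/3,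
   so that inversion is continuous there. *)
have I s k : A2_digits s -> 0 <= contfrac (w ++ mkseq s k) <= 2.
  by move=> ds; rewrite contfracE psi_le2 ?all_cat ?dw ?digits_mkseq//; lra.
apply/seteqP; split=> x /=; last first.
  case=> y [s ds cy] <-; exists s => //.
  have y0 : 0 <= y by apply: (cvgr_to_ge cy); near=> k; case/andP: (I s k ds).
  apply: cvgV; first by lra.
  by apply: cvgD => //; exact: cvg_cst.
case=> s ds cx.
have x0 : 3^-1 <= x.
  apply: (cvgr_to_ge cx); near=> k => /=.
  by have /andP[? ?] := I s k ds; rewrite lef_pV2 ?posrE; lra.
exists (x^-1 - a); last by rewrite addrC subrK invrK.
exists s => //.
have x1 : x != 0 by lra.
have P := cvgB (cvgV x1 cx) (cvg_cst a).
have E k : contfrac (w ++ mkseq s k) = ((a + contfrac (w ++ mkseq s k))^-1)^-1 - a.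
  by rewrite invrK addrC addKr.
by under eq_fun => k do rewrite E; exact: P.
Unshelve. all: by end_near. Qed.

(** Every branch is decreasing, so the parity of the length decides which endpoint comes from
    1/2. *)
Lemma A2_cylinderE w : all digit w ->
  exists u v, [/\ A2_cylinder w = `[u, v]%classic,
    (u = psi w 2^-1 /\ v = psi w 1) \/ (u = psi w 1 /\ v = psi w 2^-1),
    2^-1 <= u & u <= v].
Proof.
elim: w => [_|a w IH /andP[da dw]].
  by exists 2^-1, 1; split; [exact: A2_cylinder_nil|left|lra|lra].
have [u [v [Cw uv u0 luv]]] := IH dw.
have /andP[a0 a1] := digit_bounds da.
have v1 : v <= 1.
  have := @psi_itv _ w 1 dw; have := @psi_itv _ w 2^-1 dw.
  by case: uv => -[_ ->]; lra.
exists (a + v)^-1, (a + u)^-1; split.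
- rewrite A2_cylinder_cons// Cw; apply/seteqP; split=> x /=.
    case=> y; rewrite !in_itv /= => /andP[uy yv] <-.
    by rewrite !lef_pV2 ?posrE; lra.
  rewrite in_itv /= => /andP[vx xu].
  have i0 : 0 < (a + v)^-1 by rewrite invr_gt0; lra.
  exists (x^-1 - a); last by rewrite addrC subrK invrK.
  rewrite in_itv /=; apply/andP; split.
    by rewrite lerBrDl -[_ + _]invrK lef_pV2 ?posrE ?invr_gt0; lra.
  by rewrite lerBlDl -[a + v]invrK lef_pV2 ?posrE; lra.
- by case: uv => -[-> ->]; [right|left].
- by rewrite lef_pV2 ?posrE; lra.
- by rewrite lef_pV2 ?posrE; lra.
Qed.

Lemma measurable_A2_cylinder w : all digit w -> measurable (A2_cylinder w).
Proof. by move=> /A2_cylinderE[u [v [-> _ _ _]]]. Qed.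

Lemma measure_A2_cylinder w : all digit w ->
  lebesgue_measure (A2_cylinder w) = (2^-1 / (den w 1 * den w 2^-1))%:E.
Proof.
move=> dw; have := @psi_dist _ w 1 2^-1 dw ler01.
have [u [v [-> uv _ luv]]] := A2_cylinderE dw.
rewrite (ger0_norm (x := 1 - _)); last by lra.
have -> : 1 - 2^-1 = 2^-1 :> R by lra.
move=> <-; last by lra.
rewrite lebesgue_measure_itv /= lte_fin.
have -> : `|psi w 1 - psi w 2^-1| = v - u.
  by case: uv => -[<- <-]; [rewrite ger0_norm|rewrite ler0_norm]; lra.
by move: luv; rewrite le_eqVlt => /predU1P[->|->]; rewrite ?ltxx ?subrr// EFinD.
Qed.

End Cylinder.

(** * The transfer operator and its iterates on the logarithm *)

Section Transfer.
Context {R : realType}.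
Implicit Types (x y u v K : R) (f g : R -> R).

(** The transfer operator normalised by the invariant density [dens]: the weight of the branch T is
    dens (T x) |T' x| / dens x. The two weights sum to 1, so this is also the operator of a Markov
    chain that picks one of the two branches. *)
Definition transfer f x : R :=
  ((1 + x) * f (1 + x)^-1 + (2 + x) * f (2^-1 + x)^-1) / (3 + 2 * x).

Lemma branch_itv a x : digit a -> 2^-1 <= x <= 1 -> 2^-1 <= (a + x)^-1 <= 1.
Proof.
by move=> da; apply: (@psi_itv _ [:: a]); rewrite /= da.
Qed.

Lemma branch_dist a u v : digit a -> 0 <= u -> 0 <= v ->
  `|(a + u)^-1 - (a + v)^-1| = `|u - v| / ((a + u) * (a + v)).
Proof.
move=> da u0 v0; have := @psi_dist _ [:: a] u v.
by rewrite /= da !mulr1; apply.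
Qed.

Lemma digit_half : digit (2^-1 : R). Proof. by rewrite /digit eqxx. Qed.

Lemma digit1 : digit (1 : R). Proof. by rewrite /digit eqxx orbT. Qed.

(** On [1/2, 1] the branch of digit 1 contracts by 4/9 and has weight at least 3/8, while the other
    only fails to expand. The change of the weights adds at most 1/16 times 1/3, the largest
    distance between the two images of a point. In total 1 - (3/8)(5/9) + 1/48 = 13/16. *)
Lemma transfer_lip f K : 0 <= K ->
  (forall u v, 2^-1 <= u <= 1 -> 2^-1 <= v <= 1 ->
    `|f u - f v| <= K * `|u - v|) ->
  forall u v, 2^-1 <= u <= 1 -> 2^-1 <= v <= 1 ->
    `|transfer f u - transfer f v| <= 13 / 16 * K * `|u - v|.
Proof.
move=> K0 lf u v uI vI.
have u1I := branch_itv digit1 uI; have u2I := branch_itv digit_half uI.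
have v1I := branch_itv digit1 vI; have v2I := branch_itv digit_half vI.
have L1 := lf _ _ u1I v1I; have L2 := lf _ _ u2I v2I.
have L3 := lf _ _ v1I v2I; move: L1 L2 L3; clear lf.
have /andP[u0 u1] := uI; have /andP[v0 v1] := vI.
rewrite !branch_dist ?digit1 ?digit_half//; try lra.
have -> : `|(1 + v)^-1 - (2^-1 + v)^-1| = 2^-1 / ((1 + v) * (2^-1 + v)).
  clear -v0 v1; rewrite ler0_norm; first by field; lra.
  by rewrite subr_le0 lef_pV2 ?posrE; lra.
set d := `|u - v|; have d0 : 0 <= d by exact: normr_ge0.
move=> L1 L2 L3.
have -> : transfer f u - transfer f v =
    (1 + u) / (3 + 2 * u) * (f (1 + u)^-1 - f (1 + v)^-1) +
    (2 + u) / (3 + 2 * u) * (f (2^-1 + u)^-1 - f (2^-1 + v)^-1) +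
    (u - v) / ((3 + 2 * u) * (3 + 2 * v)) * (f (1 + v)^-1 - f (2^-1 + v)^-1).
  by rewrite /transfer; field; lra.
have [p pE] : exists p, p = (1 + u) / (3 + 2 * u) by eexists.
rewrite -pE.
have -> : (2 + u) / (3 + 2 * u) = 1 - p by rewrite pE; field; lra.
have p0 : 3 / 8 <= p <= 1.
  by rewrite pE; apply/andP; split; [rewrite ler_pdivlMr|rewrite ler_pdivrMr]; lra.
have /andP[p38 p1] := p0.
rewrite (le_trans (ler_normD _ _))// (le_trans (lerD (ler_normD _ _) (lexx _)))//.
rewrite !normrM (ger0_norm (x := p)) ?(ger0_norm (x := 1 - p)); [|lra..].
rewrite -/d; have q : `|((3 + 2 * u) * (3 + 2 * v))^-1| <= 1 / 16.
  rewrite ger0_norm ?invr_ge0; last by nra.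
  by rewrite div1r lef_pV2 ?posrE; nra.
have B1 : K * (d / ((1 + u) * (1 + v))) <= K * (d * (4 / 9)).
  rewrite ler_wpM2l// ler_wpM2l// -[leRHS]invrK lef_pV2 ?posrE ?invr_gt0; nra.
have B2 : K * (d / ((2^-1 + u) * (2^-1 + v))) <= K * d.
  have P : 1 <= (2^-1 + u) * (2^-1 + v) by nra.
  by rewrite ler_wpM2l// ler_pdivrMr ?ler_peMr//; lra.
have B3 : K * (2^-1 / ((1 + v) * (2^-1 + v))) <= K * (1 / 3).
  rewrite ler_wpM2l// ler_pdivrMr; nra.
have T1 : p * `|f (1 + u)^-1 - f (1 + v)^-1| <= p * (K * (d * (4 / 9))).
  by rewrite ler_wpM2l//; lra.
have T2 : (1 - p) * `|f (2^-1 + u)^-1 - f (2^-1 + v)^-1| <= (1 - p) * (K * d).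
  by rewrite ler_wpM2l//; lra.
have T3 : d * `|((3 + 2 * u) * (3 + 2 * v))^-1| * `|f (1 + v)^-1 - f (2^-1 + v)^-1|
    <= d * (1 / 16) * (K * (1 / 3)).
  apply: ler_pM => //; last lra.
    by rewrite mulr_ge0.
  by rewrite ler_wpM2l.
have : p * (K * d) >= 3 / 8 * (K * d) by rewrite ler_wpM2r// mulr_ge0.
move=> T4; apply: (le_trans (lerD (lerD T1 T2) T3)); lra.
Qed.

Lemma transfer_bound f K :
  (forall u, 2^-1 <= u <= 1 -> `|f u| <= K) ->
  forall u, 2^-1 <= u <= 1 -> `|transfer f u| <= K.
Proof.
move=> bf u uI.
have B1 := bf _ (branch_itv digit1 uI); have B2 := bf _ (branch_itv digit_half uI).
move: B1 B2; rewrite !ler_norml => /andP[? ?] /andP[? ?]; have /andP[? ?] := uI.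
rewrite /transfer ler_pdivlMr ?ler_pdivrMr; [|lra..].
by apply/andP; split; nra.
Qed.

Lemma transfer_cont f : (forall x, 0 < x -> {for x, continuous f}) ->
  forall x, 0 < x -> {for x, continuous (transfer f)}.
Proof.
move=> cf x x0; rewrite /transfer.
have cB a : 0 <= a -> {for x, continuous (fun x => f (a + x)^-1)}.
  move=> a0; apply: (@continuous_comp _ _ _ (fun x => (a + x)^-1) f).
    apply: cvgV; first by lra.
    by apply: cvgD; [exact: cvg_cst|exact: cvg_id].
  by apply: cf; rewrite invr_gt0; lra.
apply: cvgM; last first.
  apply: cvgV; first by lra.
  by apply: cvgD; [exact: cvg_cst|apply: cvgM; [exact: cvg_cst|exact: cvg_id]].
by apply: cvgD; (apply: cvgM;
  [apply: cvgD; [exact: cvg_cst|exact: cvg_id]|apply: cB; lra]).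
Qed.

Lemma ln_lip u v : 2^-1 <= u <= 1 -> 2^-1 <= v <= 1 ->
  `|ln u - ln v| <= 2 * `|u - v|.
Proof.
wlog vu : u v / v <= u.
  move=> H uI vI; have [|/ltW] := leP v u; first by move=> /H; apply.
  by move=> /H; rewrite distrC (distrC u); apply.
move=> /andP[u0 u1] /andP[v0 v1].
have lvu : ln v <= ln u by rewrite ler_ln ?posrE; lra.
rewrite !ger0_norm ?subr_ge0//.
rewrite -ln_div ?posrE; [|lra..].
have -> : u / v = 1 + (u - v) / v by field; lra.
have ? : 0 <= (u - v) / v by rewrite divr_ge0; lra.
apply: le_trans (le_ln1Dx _) _; first by lra.
by rewrite ler_pdivrMr; nra.
Qed.

Definition lnt k : R -> R := iter k transfer (@ln R).

Lemma lnt_lip k u v : 2^-1 <= u <= 1 -> 2^-1 <= v <= 1 ->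
  `|lnt k u - lnt k v| <= 2 * (13 / 16) ^+ k * `|u - v|.
Proof.
elim: k u v => [|k IH] u v uI vI; first by rewrite expr0 mulr1; exact: ln_lip.
rewrite exprS mulrCA; apply: transfer_lip => //.
Qed.

Lemma lnt_bound k u : 2^-1 <= u <= 1 -> `|lnt k u| <= 1.
Proof.
elim: k u => [|k IH] u uI; last exact: transfer_bound.
have /andP[u0 u1] := uI; have := @ln_lip u 1 uI; rewrite ln1 subr0 /= => H.
have {}H := H ltac:(lra); apply: (le_trans H); rewrite ler0_norm; lra.
Qed.

Lemma lnt_cont k x : 0 < x -> {for x, continuous (lnt k)}.
Proof.
elim: k x => [|k IH] x x0; first exact: continuous_ln.
exact: transfer_cont.
Qed.

Definition lnt_sum m x : R := \sum_(k < m) lnt k x.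

Lemma lnt_sum_bound m u : 2^-1 <= u <= 1 -> `|lnt_sum m u| <= m%:R.
Proof.
move=> uI; rewrite (le_trans (ler_norm_sum _ _ _))//.
apply: le_trans (ler_sum _ (fun (i : 'I_m) _ => lnt_bound i uI)) _.
by rewrite sumr_const card_ord.
Qed.

(* [lnt_sum m] solves the Poisson equation for [ln] up to the error [lnt m]. *)
Lemma transfer_lnt_sum m x : transfer (lnt_sum m) x = lnt_sum m x - ln x + lnt m x.
Proof.
elim: m => [|m IH].
  by rewrite /lnt_sum /transfer !big_ord0 !mulr0 addr0 mul0r sub0r addNr.
rewrite /lnt_sum big_ord_recr /= -/(lnt_sum m x).
have -> : transfer (fun x => \sum_(k < m.+1) lnt k x) x =
    transfer (lnt_sum m) x + transfer (lnt m) x.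
  rewrite /transfer !big_ord_recr /= -!/(lnt_sum m _) -mulrDl; congr (_ / _); ring.
by rewrite IH; ring.
Qed.

End Transfer.

(** * Invariance of the density and convergence to the mean *)

Section InvariantDensity.
Context {R : realType}.
Implicit Types (x y u v K : R) (f g k P : R -> R).
Local Notation mu := (@lebesgue_measure R).

Definition dens x : R := ((x + 1) * (x + 2))^-1.

Lemma dens_cont x : 0 < x -> {for x, continuous dens}.
Proof.
move=> x0; apply: cvgV; first by nra.
by apply: cvgM; apply: cvgD;
  [exact: cvg_id|exact: cvg_cst|exact: cvg_id|exact: cvg_cst].
Qed.

Lemma pos_within f a b : 0 < a -> (forall x, 0 < x -> {for x, continuous f}) ->
  {within `[a, b], continuous f}.
Proof.
move=> a0 cf; apply: continuous_in_subspaceT => x.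
rewrite inE /= in_itv /= => /andP[ax _]; apply: cf; exact: lt_le_trans ax.
Qed.

Lemma pos_integrable f a b : 0 < a ->
  (forall x, 0 < x -> {for x, continuous f}) ->
  mu.-integrable `[a, b] (EFin \o f).
Proof.
move=> a0 cf; apply: continuous_compact_integrable; first exact: segment_compact.
exact: pos_within.
Qed.

(** Integration starts at 1/4 so that the derivative is two-sided at 1/2 too, as the chain rule
    along the branches requires. *)
Lemma pos_antiderivative k : (forall x, 0 < x -> {for x, continuous k}) ->
  exists P, forall x, 3^-1 <= x -> is_derive x (1 : R) P (k x).
Proof.
move=> ck; exists (fun x => \int[mu]_(t in `[4^-1, x]) k t) => x x0.
have [||||dP <-] := @continuous_FTC1_closed R k 4^-1 x (x + 1).
- by rewrite ltrDl.
- by apply: pos_integrable => //; rewrite invr_gt0.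
- by lra.
- by apply: ck; lra.
by rewrite derive1E; exact: derivableP.
Qed.

Lemma pos_Rintegral k P : (forall x, 0 < x -> {for x, continuous k}) ->
  (forall x, 2^-1 <= x <= 1 -> is_derive x (1 : R) P (k x)) ->
  \int[mu]_(x in `[2^-1, 1]) k x = P 1 - P 2^-1.
Proof.
move=> ck dP; have cP x : 2^-1 <= x <= 1 -> {for x, continuous P}.
  move=> /dP dx; apply: differentiable_continuous.
  by apply/derivable1_diffP; exact: ex_derive.
rewrite /Rintegral (@continuous_FTC2 R k P) //.
- by lra.
- by apply: pos_within => //; lra.
- split.
  + move=> x; rewrite in_itv /= => /andP[x0 x1].
    have xI : 2^-1 <= x <= 1 by lra.
    by have dx := dP x xI; exact: ex_derive.
  + by apply: cvg_at_right_filter; apply: cP; lra.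
  + by apply: cvg_at_left_filter; apply: cP; lra.
- move=> x; rewrite in_itv /= => /andP[x0 x1].
  have xI : 2^-1 <= x <= 1 by lra.
  by have dx := dP x xI; rewrite derive1E derive_val.
Qed.

Lemma is_derive_branch a P x b : 0 < a + x -> is_derive (a + x)^-1 (1 : R) P b ->
  is_derive x (1 : R) (fun x => P (a + x)^-1) (- (b / (a + x) ^+ 2)).
Proof.
move=> ax dP.
have d1 : is_derive x (1 : R) (fun x => (a + x)^-1) (- ((a + x) ^+ 2)^-1).
  have /= := @is_deriveV R (fun x => a + x) x 1 1.
  rewrite -exprVn /GRing.scale /= mulr1 exprVn; apply; first by lra.
  by apply: is_derive_eq; rewrite add0r mulr1.
have := @is_derive1_comp R P (fun x => (a + x)^-1) x _ _ dP d1.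
by rewrite mulrN.
Qed.

(** Change of variables on both branches, done with antiderivatives: the branch images [1/2, 2/3]
    and [2/3, 1] fill the interval, and the two values of [P] at 2/3 cancel. *)
Lemma transfer_Rintegral f : (forall x, 0 < x -> {for x, continuous f}) ->
  \int[mu]_(x in `[2^-1, 1]) (transfer f x * dens x) =
  \int[mu]_(x in `[2^-1, 1]) (f x * dens x).
Proof.
move=> cf.
have cfd x : 0 < x -> {for x, continuous (fun x => f x * dens x)}.
  by move=> x0; apply: cvgM; [exact: cf|exact: dens_cont].
have ctd x : 0 < x -> {for x, continuous (fun x => transfer f x * dens x)}.
  by move=> x0; apply: cvgM; [exact: transfer_cont|exact: dens_cont].
have [P dP] := pos_antiderivative cfd.
have E1 : \int[mu]_(x in `[2^-1, 1]) (f x * dens x) = P 1 - P 2^-1.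
  by apply: pos_Rintegral => // x xI; apply: dP; lra.
pose Q x := - P (1 + x)^-1 - P (2^-1 + x)^-1.
have E2 : \int[mu]_(x in `[2^-1, 1]) (transfer f x * dens x) = Q 1 - Q 2^-1.
  apply: pos_Rintegral => // x xI.
  have D a : digit a -> is_derive x (1 : R) (fun x => P (a + x)^-1)
      (- (f (a + x)^-1 * dens (a + x)^-1 / (a + x) ^+ 2)).
    move=> da; have /andP[a0 a1] := digit_bounds da; have /andP[x0 x1] := xI.
    apply: is_derive_branch; first by lra.
    apply: (dP (a + x)^-1); have /andP[y0 _] := branch_itv da xI.
    by apply: le_trans y0; lra.
  have d1 := D _ digit1; have d2 := D _ digit_half.
  apply: is_derive_eq; rewrite /transfer /dens.
  move: (f _) (f _) => A B; field; lra.
rewrite E1 E2 /Q.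
have -> : (2^-1 + 2^-1)^-1 = 1 :> R by field.
have -> : (1 + 1)^-1 = 2^-1 :> R by field.
have -> : (2^-1 + 1)^-1 = (1 + 2^-1)^-1 :> R by rewrite addrC.
by ring.
Qed.

Lemma dens_Rintegral : \int[mu]_(x in `[2^-1, 1]) dens x = ln (10 / 9).
Proof.
pose Q x : R := ln (1 + x) - ln (2 + x).
have -> : \int[mu]_(x in `[2^-1, 1]) dens x = Q 1 - Q 2^-1.
  apply: pos_Rintegral => [|x xI]; first exact: dens_cont.
  have D (a : R) : 0 <= a -> is_derive x (1 : R) (fun x => ln (a + x)) (a + x)^-1.
    move=> a0.
    have := @is_derive1_comp R (@ln R) (fun x => a + x) x (a + x)^-1 1.
    rewrite mulr1; apply; first by apply: is_derive1_ln; lra.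
    by apply: is_derive_eq; rewrite add0r mulr1.
  have d1 := D 1 ler01; have d2 := D 2 (ler0n _ 2).
  by apply: is_derive_eq; rewrite /dens; field; lra.
rewrite /Q -!ln_div ?posrE; try lra.
  by congr ln; field.
all: by apply: divr_gt0; lra.
Qed.

Definition ln_mean : R :=
  (\int[mu]_(x in `[2^-1, 1]) (ln x * dens x)) / ln (10 / 9).

Lemma A2_GE : - 2 * A2_G R = 2 * ln_mean.
Proof.
rewrite /A2_G mulrNN; congr (_ * _); rewrite /ln_mean.
have L : mu.-integrable `[2^-1, 1] (EFin \o (fun x => ln x * dens x)).
  apply: pos_integrable => [|x x0]; first by lra.
  by apply: cvgM; [exact: continuous_ln|exact: dens_cont].
rewrite -RintegralZr//; apply: eq_Rintegral => x _.
rewrite /dens -[RHS]mulrA -invfM; congr (_ / _).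
by ring.
Qed.

Lemma ln109_gt0 : 0 < ln (10 / 9 : R).
Proof. by apply: ln_gt0; lra. Qed.

Lemma lnt_Rintegral n :
  \int[mu]_(x in `[2^-1, 1]) (lnt n x * dens x) = ln_mean * ln (10 / 9).
Proof.
elim: n => [|n IH]; first by rewrite /ln_mean divfK// gt_eqF// ln109_gt0.
by rewrite -IH transfer_Rintegral// => x; exact: lnt_cont.
Qed.

(** By [lnt_lip] on an interval of length 1/2, [lnt n] oscillates by at most (13/16)^n, and
    invariance keeps its mean equal to [ln_mean]. *)
Lemma lnt_mean_dist n x : 2^-1 <= x <= 1 -> `|lnt n x - ln_mean| <= (13 / 16) ^+ n.
Proof.
move=> xI; set e := (13 / 16) ^+ n.
have osc y : 2^-1 <= y <= 1 -> lnt n x - e <= lnt n y <= lnt n x + e.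
  move=> yI; have := lnt_lip n xI yI; rewrite -/e.
  have e0 : 0 <= e by rewrite exprn_ge0//; lra.
  have : `|x - y| <= 2^-1 by rewrite ler_norml; lra.
  move=> xy /le_trans /(_ (ler_wpM2l _ xy)); rewrite ler_norml => H.
  by have := H ltac:(lra); lra.
have I1 : mu.-integrable `[2^-1, 1] (EFin \o (fun x => lnt n x * dens x)).
  apply: pos_integrable => [|y y0]; first by lra.
  by apply: cvgM; [exact: lnt_cont|exact: dens_cont].
have I2 : mu.-integrable `[2^-1, 1] (EFin \o dens).
  by apply: pos_integrable => [|y y0]; [lra|exact: dens_cont].
have I3 z : mu.-integrable `[2^-1, 1] (EFin \o (fun x => z * dens x)).
  apply: pos_integrable => [|y y0]; first by lra.
  by apply: cvgM; [exact: cvg_cst|exact: dens_cont].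
have IE z : \int[mu]_(x in `[2^-1, 1]) (z * dens x) = z * ln (10 / 9).
  by rewrite RintegralZl// dens_Rintegral.
have d0 y : 2^-1 <= y <= 1 -> 0 <= dens y.
  by move=> yI; rewrite invr_ge0; nra.
have lo : (lnt n x - e) * ln (10 / 9) <= ln_mean * ln (10 / 9).
  rewrite -(lnt_Rintegral n) -IE; apply: le_Rintegral => // y /=.
  by rewrite in_itv /= => yI; rewrite ler_wpM2r ?d0//; case/andP: (osc y yI).
have hi : ln_mean * ln (10 / 9) <= (lnt n x + e) * ln (10 / 9).
  rewrite -(lnt_Rintegral n) -IE; apply: le_Rintegral => // y /=.
  by rewrite in_itv /= => yI; rewrite ler_wpM2r ?d0//; case/andP: (osc y yI).
move: lo hi; rewrite !ler_pM2r ?ln109_gt0// => lo hi.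
by rewrite ler_norml; clear -lo hi; lra.
Qed.

Lemma lnt_mean_near (e : R) : 0 < e ->
  exists n, forall x, 2^-1 <= x <= 1 -> `|lnt n x - ln_mean| <= e.
Proof.
move=> e0.
have G : geometric 1 (13 / 16 : R) @ \oo --> 0.
  by apply: cvg_geometric; rewrite ger0_norm; lra.
have [n _ /(_ n (leqnn n)) H] := cvgr_le _ G _ e0.
exists n => x xI; apply: le_trans (lnt_mean_dist n xI) _.
by move: H; rewrite /geometric /= mul1r.
Qed.

End InvariantDensity.

(** * Words as trajectories of the chain, and the martingale *)

Section Words.
Context {R : realType}.
Implicit Types (w : seq R) (s t e K : R) (m n : nat).

Fixpoint words n : seq (seq R) := if n is n'.+1 then
  [seq 2^-1 :: w | w <- words n'] ++ [seq 1 :: w | w <- words n'] else [:: [::]].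

Lemma words_digit n w : w \in words n -> all digit w.
Proof.
elim: n w => [|n IH] w; first by rewrite inE => /eqP ->.
rewrite /= mem_cat => /orP[] /mapP[v /IH dv ->] /=.
  by rewrite digit_half.
by rewrite digit1.
Qed.

Lemma mem_words w : all digit w -> w \in words (size w).
Proof.
elim: w => [|a w IH] //= /andP[/digitP[]-> /IH wi]; rewrite mem_cat.
  by rewrite (map_f (cons _)).
by rewrite (map_f (cons _) wi) orbT.
Qed.

Lemma big_words (F : seq R -> R) n : \sum_(w <- words n.+1) F w =
  \sum_(w <- words n) (F (2^-1 :: w) + F (1 :: w)).
Proof. by rewrite [RHS]big_split /= big_cat !big_map. Qed.

(** Up to the factor [weight [::]], which is 1/6, the probability that the chain of [transfer]
    started at 1 produces [w], last digit first. *)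
Definition weight w : R := dens (psi w 1) / den w 1 ^+ 2.

Lemma weight_cons w (f : R -> R) : all digit w ->
  weight (2^-1 :: w) * f (psi (2^-1 :: w) 1) + weight (1 :: w) * f (psi (1 :: w) 1)
  = weight w * transfer f (psi w 1).
Proof.
move=> dw; have D := den_gt0 dw ler01; have P := psi_ge0 dw ler01.
rewrite /weight /transfer /dens /=; move: (f _) (f _) => A B.
by move: (psi w 1) (den w 1) P D => p d P D; field; rewrite !gt_eqF//; nra.
Qed.

Lemma weight_ge0 w : all digit w -> 0 <= weight w.
Proof.
move=> dw; have P := psi_ge0 dw ler01.
by rewrite divr_ge0 ?sqr_ge0// invr_ge0 mulr_ge0//; lra.
Qed.

(** [den_half] bounds the length by [den w 1 ^- 2], and [dens] is at least 1/6 on [1/2, 1]. *)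
Lemma measure_weight w : all digit w ->
  (lebesgue_measure (A2_cylinder w) <= (6 * weight w)%:E)%E.
Proof.
move=> dw; rewrite measure_A2_cylinder// lee_fin /weight /dens.
have half : 0 <= 2^-1 :> R by lra.
have D1 := den_gt0 dw ler01; have D2 := den_gt0 dw half.
have /andP[D D'] := den_half dw.
have /andP[p0 p1] : 2^-1 <= psi w 1 <= 1 by apply: psi_itv => //; lra.
apply: (@le_trans _ _ (den w 1 ^- 2)).
  by rewrite ler_pdivrMr ?mulr_gt0// ler_pdivlMl ?exprn_gt0//; nra.
rewrite mulrA ler_peMl ?invr_ge0 ?sqr_ge0//.
by rewrite ler_pdivlMr ?mul1r; nra.
Qed.

(** Each increment is [lnt_sum m] at the new position minus its conditional mean given the old one,
    hence a martingale under [weight] as digits are prepended. *)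
Fixpoint mart m w : R := if w is a :: w' then
  mart m w' + lnt_sum m (psi w 1) - transfer (lnt_sum m) (psi w' 1) else 0.

(** From (1 - t) exp t <= 1 and (1 - t)(1 + t + 2 t^2) = 1 + t^2 (1 - 2 t) >= 1. *)
Lemma expR_quad t : t <= 2^-1 -> expR t <= 1 + t + 2 * t ^+ 2.
Proof.
move=> t2; have := expR_ge1Dx (- t); rewrite expRN => H.
have E0 := expR_gt0 t; move: (expR t) E0 H => E E0.
rewrite -(ler_pM2r E0) mulVf ?gt_eqF// => H; rewrite expr2.
by nra.
Qed.

(** The increment is at most 2K in absolute value, so [expR_quad] applies; its linear term averages
    to 0 and its quadratic term is at most 2 (2 s K)^2. *)
Lemma transfer_exp m s y K : 2^-1 <= y <= 1 -> m%:R <= K -> 2 * `|s| * K <= 2^-1 ->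
  transfer (fun x => expR (s * (lnt_sum m x - transfer (lnt_sum m) y))) y
  <= 1 + 8 * s ^+ 2 * K ^+ 2.
Proof.
move=> yI mK sK; set g := lnt_sum m.
have gK x : 2^-1 <= x <= 1 -> `|g x| <= K.
  by move=> xI; exact: le_trans (lnt_sum_bound m xI) mK.
have TK := transfer_bound gK yI.
have [T TT] : exists T, T = transfer g y by eexists.
rewrite -TT in TK *.
have B x : 2^-1 <= x <= 1 -> expR (s * (g x - T)) <=
    1 + s * (g x - T) + 8 * s ^+ 2 * K ^+ 2.
  move=> xI; set t := s * _; have tK : `|t| <= 2 * `|s| * K.
    rewrite /t normrM -mulrA mulrCA ler_wpM2l//.
    by apply: le_trans (ler_normB _ _) _; have := gK _ xI; lra.
  have t2 : t <= 2^-1 by apply: le_trans (ler_norm _) _; exact: le_trans sK.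
  apply: le_trans (expR_quad t2) _; rewrite lerD2l.
  rewrite -(real_normK (num_real t)) -(real_normK (num_real s)).
  have := normr_ge0 t; have := normr_ge0 s.
  have K0 : 0 <= K by apply: le_trans (gK _ xI).
  move: `|t| `|s| tK => t' s' tK s0 t0; rewrite !expr2; nra.
have /andP[y0 y1] := yI.
have TE : T * (3 + 2 * y) =
    (1 + y) * g (1 + y)^-1 + (2 + y) * g (2^-1 + y)^-1.
  by rewrite TT /transfer divfK//; lra.
have := B _ (branch_itv digit1 yI); have := B _ (branch_itv digit_half yI).
rewrite /transfer ler_pdivrMr; last by lra.
move: TE; set X1 := g (1 + y)^-1; set X2 := g (2^-1 + y)^-1.
set E1 := expR (s * (X1 - T)); set E2 := expR (s * (X2 - T)).
move: (X1) (X2) (E1) (E2) => {}X1 {}X2 {}E1 {}E2.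
clear -y0 y1 => TE H2 H1.
have H1' : (2 + y) * E2 <= (2 + y) * (1 + s * (X2 - T) + 8 * s ^+ 2 * K ^+ 2).
  by rewrite ler_wpM2l//; lra.
have H2' : (1 + y) * E1 <= (1 + y) * (1 + s * (X1 - T) + 8 * s ^+ 2 * K ^+ 2).
  by rewrite ler_wpM2l//; lra.
have sTE : s * (T * (3 + 2 * y)) = s * ((1 + y) * X1 + (2 + y) * X2) by rewrite TE.
lra.
Qed.

End Words.

(** * Exponential bounds, Borel-Cantelli and the link to denominators *)

Section LargeDeviations.
Context {R : realType}.
Implicit Types (w : seq R) (s t e K : R) (m n : nat).
Local Notation mu := (@lebesgue_measure R).

(** The empty word contributes 1/6; by [weight_cons], averaging over each prepended digit is one
    application of [transfer], which [transfer_exp] bounds. *)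
Lemma mart_moment m s K n : m%:R <= K -> 2 * `|s| * K <= 2^-1 ->
  \sum_(w <- words n) weight w * expR (s * mart m w)
  <= 6^-1 * (1 + 8 * s ^+ 2 * K ^+ 2) ^+ n.
Proof.
move=> mK sK; elim: n => [|n IH].
  rewrite /= big_seq1 /= mulr0 expR0 /weight /dens /= expr1n expr0 divr1.
  by rewrite (_ : (1 + 1) * (1 + 2) = 6 :> R); [lra|ring].
rewrite big_words exprS mulrCA; set C := 1 + _; have C0 : 0 <= C.
  by have := sqr_ge0 s; have := sqr_ge0 K; rewrite /C; nra.
apply: le_trans (ler_wpM2l C0 IH); rewrite big_distrr /= !big_seq.
apply: ler_sum => w /words_digit dw.
pose f x := expR (s * (lnt_sum m x - transfer (lnt_sum m) (psi w 1))).
have E a : expR (s * (mart m w + lnt_sum m (a + psi w 1)^-1 -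
    transfer (lnt_sum m) (psi w 1))) = f (a + psi w 1)^-1 * expR (s * mart m w).
  by rewrite /f -expRD; congr expR; ring.
rewrite /= !E 2!(mulrA (weight _) (f _)) -mulrDl weight_cons//.
rewrite (mulrA C (weight w)) (mulrC C (weight w)).
rewrite ler_wpM2r ?expR_ge0// ler_wpM2l ?weight_ge0//.
by apply: transfer_exp => //; apply: psi_itv => //; lra.
Qed.

Definition bad m e n : set R :=
  \big[setU/set0]_(w <- words n | n%:R * e <= `|mart m w|) A2_cylinder w.

Lemma measurable_bad m e n : measurable (bad m e n).
Proof.
rewrite /bad big_seq_cond; elim/big_ind: _ => //.
  by move=> A B; exact: measurableU.
by move=> w /andP[/words_digit dw _]; exact: measurable_A2_cylinder.
Qed.

Lemma measure_big_setU (I : Type) (r : seq I) (Q : pred I)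
    (F : I -> set R) (c : I -> R) :
  (forall i, Q i -> measurable (F i)) ->
  (forall i, Q i -> (mu (F i) <= (c i)%:E)%E) ->
  (mu (\big[setU/set0]_(i <- r | Q i) F i) <= (\sum_(i <- r | Q i) c i)%:E)%E.
Proof.
move=> mF Fc.
suff [] : measurable (\big[setU/set0]_(i <- r | Q i) F i) /\
  (mu (\big[setU/set0]_(i <- r | Q i) F i) <= (\sum_(i <- r | Q i) c i)%:E)%E by [].
elim/big_rec2: _ => [|i y A Qi [mA Ay]]; first by rewrite measure0.
split; first exact: measurableU (mF _ Qi) mA.
rewrite EFinD; apply: le_trans (measureU2 mu (mF _ Qi) mA) _.
by apply: leeD => //; exact: Fc.
Qed.

(** A Chernoff bound for both signs of [mart]. The 6 of [measure_weight] cancels the 1/6 of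
    [mart_moment], and the two signs leave the factor 2. *)
Lemma measure_bad m s e K n : m%:R <= K -> 0 <= s -> 2 * s * K <= 2^-1 ->
  (mu (bad m e n) <=
    (2 * (expR (- (s * e)) * (1 + 8 * s ^+ 2 * K ^+ 2)) ^+ n)%:E)%E.
Proof.
move=> mK s0 sK; rewrite /bad big_seq_cond.
pose c w := 6 * weight w * (expR (s * mart m w) + expR (- s * mart m w))
  * expR (- (s * e)) ^+ n.
apply: (@le_trans _ _
  (\sum_(w <- words n | (w \in words n) && (n%:R * e <= `|mart m w|)) c w)%:E).
  apply: measure_big_setU => w /andP[/words_digit dw ew].
    exact: measurable_A2_cylinder.
  apply: le_trans (measure_weight dw) _; rewrite lee_fin /c -mulrA.
  have W0 : 0 <= 6 * weight w by rewrite mulr_ge0 ?weight_ge0.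
  rewrite ler_peMr// -expRM_natl -ler_pdivrMr ?expR_gt0// div1r -expRN.
  apply: (@le_trans _ _ (expR (s * `|mart m w|))).
    by rewrite ler_expR mulrN opprK mulrCA ler_wpM2l.
  case: (ger0P (mart m w)) => _; rewrite ?lerDl ?expR_ge0//.
  by rewrite mulrN -mulNr lerDr expR_ge0.
rewrite lee_fin; apply: (@le_trans _ _ (\sum_(w <- words n) c w)).
  rewrite -big_seq_cond big_mkcond /= !big_seq; apply: ler_sum => w /words_digit dw.
  case: ifP => // _; rewrite /c mulr_ge0 ?exprn_ge0 ?expR_ge0//.
  by rewrite mulr_ge0 ?addr_ge0 ?expR_ge0// mulr_ge0 ?weight_ge0.
rewrite /c -big_distrl /= exprMn mulrCA mulrC ler_wpM2l ?exprn_ge0 ?expR_ge0//.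
have P := @mart_moment m s K n mK; have N := @mart_moment m (- s) K n mK.
rewrite sqrrN normrN (ger0_norm s0) in P N.
have -> : \sum_(w <- words n) 6 * weight w *
    (expR (s * mart m w) + expR (- s * mart m w))
  = 6 * (\sum_(w <- words n) weight w * expR (s * mart m w)) +
    6 * (\sum_(w <- words n) weight w * expR (- s * mart m w)).
  rewrite !big_distrr -big_split /=; apply: eq_bigr => w _; ring.
have {}P := P sK; have {}N := N sK; clear -P N; lra.
Qed.

Lemma geometric_series_bound (F : nat -> \bar R) (c r : R) : 0 <= c -> 0 <= r < 1 ->
  (forall n, 0 <= F n)%E -> (forall n, F n <= (c * r ^+ n)%:E)%E ->
  (\sum_(0 <= n <oo) F n < +oo)%E.
Proof.
move=> c0 /andP[r0 r1] F0 Fr.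
apply: (@le_lt_trans _ _ (c / (1 - r))%:E); last exact: ltry.
apply: lime_le; first by apply: is_cvg_nneseries => *; exact: F0.
near=> n; apply: (@le_trans _ _ (\sum_(0 <= k < n) (c * r ^+ k)%:E)%E).
  by apply: lee_sum => k _; exact: Fr.
rewrite sumEFin lee_fin.
have := @geometric_seriesE R c r; rewrite lt_eqF// => /(_ isT).
move=> /(congr1 (fun f => f n)).
rewrite /series /geometric /= => ->.
rewrite ler_pM2r ?invr_gt0 ?subr_gt0// ler_piMr// lerBlDl lerDr.
exact: exprn_ge0.
Unshelve. all: by end_near. Qed.

Lemma lim_sup_bad m e : 0 < e <= 1 -> mu (lim_sup_set (bad m e)) = 0%E.
Proof.
move=> /andP[e0 e1]; set K : R := m%:R + 1; have K1 : 1 <= K by rewrite lerDr.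
(* The minimiser of - s e + 8 s^2 K^2, where this exponent is negative. As [e <= 1 <= K], it also
   meets the smallness condition of [measure_bad]. *)
pose s := e / (16 * K ^+ 2).
have K2 : 1 <= K ^+ 2 by rewrite expr_ge1//; lra.
have sK : s * K ^+ 2 = e / 16 by rewrite /s; field; lra.
have s0 : 0 < s by rewrite divr_gt0// mulr_gt0//; lra.
apply: lim_sup_set_cvg0; first exact: measurable_bad.
apply: (@geometric_series_bound _ 2 (expR (- (s * e)) * (1 + 8 * s ^+ 2 * K ^+ 2))).
- by [].
- have C0 : 0 <= 1 + 8 * s ^+ 2 * K ^+ 2 by have := sqr_ge0 s; nra.
  rewrite mulr_ge0 ?expR_ge0//=.
  apply: (@le_lt_trans _ _ (expR (- (s * e)) * expR (8 * s ^+ 2 * K ^+ 2))).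
    by rewrite ler_wpM2l ?expR_ge0// expR_ge1Dx.
  rewrite -expRD -[ltRHS]expR0 ltr_expR.
  have -> : 8 * s ^+ 2 * K ^+ 2 = 8 * s * (s * K ^+ 2) by ring.
  by rewrite sK; have := mulr_gt0 s0 e0; lra.
- by move=> n; exact: measure_ge0.
- move=> n; apply: measure_bad => //; [by rewrite lerDl|exact: ltW|].
  have : s * K <= s * K ^+ 2 by rewrite ler_pM2l// expr2 ler_peMl//; lra.
  by rewrite sK; lra.
Qed.

Lemma ln_den_mart m e w : (forall x, 2^-1 <= x <= 1 -> `|lnt m x - ln_mean| <= e) ->
  all digit w ->
  `|ln (den w 1) + (size w)%:R * ln_mean + mart m w| <= (size w)%:R * e + 2 * m%:R.
Proof.
move=> he dw; have I1 : 2^-1 <= (1 : R) <= 1 by lra.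
pose T : R -> R := transfer (lnt_sum m).
have TB x : 2^-1 <= x <= 1 -> `|T x| <= m%:R.
  by apply: transfer_bound => y; exact: lnt_sum_bound.
(* Each digit adds -ln x at the new position x to [ln (den w 1)]. With the two boundary terms the
   values of [T] at the old position cancel, and by the Poisson equation each digit changes the sum
   by exactly [ln_mean - lnt m x]. *)
suff H : `|ln (den w 1) + (size w)%:R * ln_mean + mart m w - T (psi w 1) + T 1|
    <= (size w)%:R * e.
  have := TB _ I1; have := TB _ (psi_itv dw I1); move: H; rewrite !ler_norml.
  clear; set X := ln _; move: (T _) (T _) => a b; lra.
elim: w dw => [_|a w IH /= /andP[da dw]].
  by rewrite /= ln1 mul0r !add0r addNr normr0 mul0r.
have := IH dw; have wI := psi_itv dw I1; have P := branch_itv da wI.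
have := he _ P; have := transfer_lnt_sum m (a + psi w 1)^-1; rewrite -/T.
have p0 : 0 < a + psi w 1 by case/andP: wI; case/andP: (digit_bounds da); lra.
rewrite lnM ?posrE ?den_gt0// lnV ?posrE// -[in X in _ -> _ -> _ -> X]natr1.
rewrite !ler_norml; set X := ln (den w 1); set Y := ln (a + _).
move: (T _) (T _) (T _) (lnt_sum _ _) (lnt _ _) => t1 t2 t3 g l.
clear; lra.
Qed.

End LargeDeviations.

(** * Almost sure asymptotics of denominators and cylinder lengths *)

Section Conclusion.
Context {R : realType}.
Local Notation mu := (@lebesgue_measure R).

Lemma A2_cylinder_mkseq (a : nat -> R) (x : R) n : A2_representation a x ->
  A2_cylinder (mkseq a n) x.
Proof.
move=> [da ca]; exists (fun k => a (n + k)%N) => [k|]; first exact: da.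
have E k : mkseq a n ++ mkseq (fun k => a (n + k)%N) k = mkseq a (k + n)%N.
  rewrite [RHS]/mkseq addnC iotaD map_cat add0n -[in iota n k](addn0 n).
  by rewrite iotaDl -map_comp.
by under eq_fun => k do rewrite E; rewrite -(cvg_shiftn n) in ca.
Qed.

Lemma bad_mem m e n (x : R) w : w \in words n -> A2_cylinder w x ->
  n%:R * e <= `|mart m w| -> bad m e n x.
Proof.
move=> wn wx we; rewrite /bad -bigcup_seq_cond /=.
by exists w => //=; rewrite wn we.
Qed.

(** A point outside the limit superior lies in only finitely many [bad] sets. The three errors n e
    come from [lnt m], from [mart], and from the constant 2m once n is large. *)
Lemma ae_ln_den (e : R) : 0 < e <= 1 ->
  {ae mu, forall x, 2^-1 <= x <= 1 -> \forall n \near \oo,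
    `|ln (den (mkseq (A2_rep x) n) 1) + n%:R * ln_mean| <= 3 * (n%:R * e)}.
Proof.
move=> eI; have /andP[e0 _] := eI; have [m he] := lnt_mean_near e0.
exists (lim_sup_set (bad m e)); split.
- apply: bigcap_measurable => [|k _]; first by exists 0%N.
  by apply: bigcup_measurable => j _; exact: measurable_bad.
- exact: lim_sup_bad.
move=> x /=; apply: contra_notP => nx xI.
have xr := A2_repP xI; have [dx _] := xr.
have [N HN] : exists N, forall n, (N <= n)%N -> ~ bad m e n x.
  apply: contra_notP nx => H N _; apply: contra_notP H => H.
  by exists N => n Nn bn; apply: H; exists n.
near=> n.
have dw := digits_mkseq n dx.
have B : `|mart m (mkseq (A2_rep x) n)| < n%:R * e.
  rewrite ltNge; apply/negP => H; apply: (HN n).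
    by near: n; exact: nbhs_infty_ge.
  apply: bad_mem H; last exact: A2_cylinder_mkseq.
  by have := mem_words dw; rewrite size_mkseq.
have M : 2 * m%:R <= n%:R * e.
  rewrite -ler_pdivrMr//; near: n; exact: nbhs_infty_ger.
have := ln_den_mart he dw; rewrite size_mkseq; move: B.
set X := ln _ + _; move: (mart _ _) => Y.
by clear -M; rewrite !ltr_norml !ler_norml; lra.
Unshelve. all: by end_near. Qed.

Lemma measure_ln_den (w : seq R) : all digit w ->
  0 < fine (mu (A2_cylinder w)) /\
  `|ln (fine (mu (A2_cylinder w))) + 2 * ln (den w 1)| <= ln 2.
Proof.
move=> dw; rewrite measure_A2_cylinder//=.
have half : 0 <= 2^-1 :> R by lra.
have D1 := den_gt0 dw ler01; have D2 := den_gt0 dw half.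
split; first by rewrite divr_gt0 ?mulr_gt0//; lra.
have /andP[D D'] := den_half dw.
have L1 : ln (den w 2^-1) <= ln (den w 1) by rewrite ler_ln ?posrE.
have L2 : ln (den w 1) <= ln 2 + ln (den w 2^-1).
  by rewrite -lnM ?posrE// ler_ln ?posrE ?mulr_gt0.
rewrite ln_div ?posrE ?mulr_gt0 ?invr_gt0// lnM ?posrE// lnV ?posrE//.
by rewrite ler_norml; clear -L1 L2; lra.
Qed.

End Conclusion.

Theorem theorem2 (R : realType) :
  {ae @lebesgue_measure R, forall x : R, x \in `[2^-1, 1]%R ->
    fine (@lebesgue_measure R (A2_cylinder_at n x)) `^ n%:R^-1
      @[n --> \oo] --> expR (- 2 * A2_G R)}.
Proof.
(* The errors 1/(j+1) are countably many, so one null set serves them all. *)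
have eI (j : nat) : 0 < (j.+1%:R^-1 : R) <= 1.
  by rewrite invr_gt0 ltr0n invf_le1 ?ltr0n// ler1n.
have := ae_foralln (fun j => ae_ln_den (eI j)).
apply: filterS => x H; rewrite in_itv /= => xI.
have dx := (A2_repP xI).1.
pose L n : R := fine (lebesgue_measure (A2_cylinder_at n x)).
have E n : L n `^ n%:R^-1 = expR (n%:R^-1 * ln (L n)).
  by have [L0 _] := measure_ln_den (digits_mkseq n dx); rewrite /powR gt_eqF.
under eq_fun => n do rewrite -/(L n) E.
apply: continuous_cvg; first exact: continuous_expR.
rewrite A2_GE; apply/cvgrPdist_le => e e0.
(* With q = n/(j+1), twice the error 3q of [ae_ln_den] and the bound [ln 2 <= q] for large n add up
   to 7q. *)
have [j je] : exists j, 7 / e < j.+1%:R.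
  exists (Num.Def.archi_bound (7 / e)); rewrite (lt_trans (archi_boundP _))//.
    by rewrite divr_ge0// ltW.
  by rewrite ltr_nat.
have N1 := @nbhs_infty_gtr R (ln 2 * j.+1%:R).
have {H} N2 := H j xI; apply: filterS2 N1 N2 => n nj H.
have [_ M] := measure_ln_den (digits_mkseq n dx).
have j0 : 0 < j.+1%:R :> R by rewrite ltr0n.
have n0 : 0 < n%:R :> R by apply: le_lt_trans nj; rewrite mulr_ge0 ?ln_ge0 ?ler1n.
have je' : 7 / j.+1%:R <= e.
  by rewrite ler_pdivrMr// mulrC -ler_pdivrMr// ltW.
have nj' : ln 2 <= n%:R / j.+1%:R :> R.
  by rewrite ler_pdivlMr//; exact: ltW nj.
move: H M nj'; rewrite -/(L n).
set q := n%:R / j.+1%:R; set D := ln (den _ _); set l := ln (L n).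
rewrite !ler_norml => H M nj'.
have qe : 7 * q <= e * n%:R by rewrite /q mulrCA mulrC ler_wpM2r// ltW.
have -> : 2 * ln_mean - n%:R^-1 * l =
    (2 * (D + n%:R * ln_mean) - (l + 2 * D)) / n%:R.
  by field; rewrite gt_eqF.
rewrite ler_pdivrMr// ler_pdivlMr//.
by clear -H M nj' qe; lra.
Qed.
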